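(* Let $f:(A,A')\to(B,B')$ be an applicative morphism of filtered opcas. Then $f$ is computationally dense if and only if there are a function $h:B'\to A'$ and an element $\mathsf{t}\in B'$ such that for all $b'\in B'$, $\mathsf{t}f(h(b'))$ is defined and $$\mathsf{t}f(h(b'))\leq b'.$$
   Context: Convention: application associates to the left, and $xf(y)$ means the application of $x$ to the element $f(y)$. An opca is a poset $(A,\leq)$ with a partial binary application $a,b\mapsto ab$ such that: (i) if $ab$ is defined, $a'\leq a$ and $b'\leq b$, then $a'b'$ is defined and $a'b'\leq ab$; (ii) there are $\mathsf{k},\mathsf{s}\in A$ such that $\mathsf{k}xy$ is defined and $\mathsf{k}xy\leq x$ for all $x,y$; $\mathsf{s}xy$ is defined for all $x,y$; and whenever $xz(yz)$ is defined, $\mathsf{s}xyz$ is defined and $\mathsf{s}xyz\leq xz(yz)$. A filtered opca $(A,A')$ is an opca $A$ with a subset $A'\subseteq A$ closed under (defined) application and containing choices for $\mathsf{k}$ and $\mathsf{s}$. An applicative morphism $(A,A')\to(B,B')$ of filtered opcas is a function $f:A\to B$ such that: (i) for all $a\in A'$ there is $b\in B'$ with $b\leq f(a)$; (ii) there is $r\in B'$ such that for all $a',a\in A$, whenever $a'a$ is defined, $rf(a')f(a)$ is defined and $rf(a')f(a)\leq f(a'a)$; (iii) there is $u\in B'$ such that for every $x\leq y$ in $A$, $uf(x)$ is defined and $uf(x)\leq f(y)$. An applicative morphism $f:(A,A')\to(B,B')$ is computationally dense if there is $m\in B'$ such that: for every $b'\in B'$ there is $a'\in A'$ such that for all $a\in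 A$, if $b'f(a)$ is defined then $a'a$ is defined, $mf(a'a)$ is defined and $mf(a'a)\leq b'f(a)$. *)

(* Defs.v *)
From HB Require Import structures.
From mathcomp Require Import all_boot all_order.
From mathcomp Require Import boolp classical_sets.

Set Implicit Arguments.
Unset Strict Implicit.
Unset Printing Implicit Defensive.

Local Open Scope order_scope.
Local Open Scope classical_set_scope.

(* Possibly undefined elements of A are terms of type [option A].  [ple x y]
   says: whenever y is defined, x is defined and x <= y; so [ple x (Some b)]
   says that x is defined and x <= b. *)
Definition ple d (A : porderType d) (x y : option A) : Prop :=
  forall b, y = Some b -> exists2 a, x = Some a & a <= b.

Definition oapp2 A (app : A -> A -> option A) (x y : option A) : option A :=
  obind (fun a => obind (app a) y) x.

Definition k_spec d (A : porderType d) (app : A -> A -> option A) (k : A) :=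
  forall x y : A,
    ple (oapp2 app (oapp2 app (Some k) (Some x)) (Some y)) (Some x).

Definition s_spec d (A : porderType d) (app : A -> A -> option A) (s : A) :=
  (forall x y : A, oapp2 app (oapp2 app (Some s) (Some x)) (Some y) <> None) /\
  (forall x y z : A,
    ple (oapp2 app (oapp2 app (oapp2 app (Some s) (Some x)) (Some y)) (Some z))
        (oapp2 app (oapp2 app (Some x) (Some z))
                   (oapp2 app (Some y) (Some z)))).

HB.mixin Record isOpca d A of Order.POrder d A := {
  opca_app : A -> A -> option A;
  opca_app_mono : forall a a' b b' : A,
    a' <= a -> b' <= b -> ple (opca_app a' b') (opca_app a b);
  opca_ks : exists k s : A, k_spec opca_app k /\ s_spec opca_app s
}.

#[short(type="opcaType")]
HB.structure Definition Opca d := { A of Order.POrder d A & isOpca d A }.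

Declare Scope opca_scope.
Delimit Scope opca_scope with opca.
Notation "x ⊙ y" := (oapp2 opca_app x y)
  (at level 40, left associativity) : opca_scope.
Notation "x ⪯ y" := (ple x y) (at level 70, no associativity) : opca_scope.
Local Open Scope opca_scope.

Definition opca_filter d (A : opcaType d) (A' : set A) : Prop :=
  (forall a b c : A, A' a -> A' b -> Some a ⊙ Some b = Some c -> A' c) /\
  (exists k s : A,
    [/\ A' k, A' s, k_spec opca_app k & s_spec opca_app s]).

Definition applicative_morphism dA (A : opcaType dA) (A' : set A)
    dB (B : opcaType dB) (B' : set B) (f : A -> B) : Prop :=
  [/\ forall a, A' a -> exists2 b, B' b & b <= f a,
      exists2 r, B' r & forall a' a : A,
        Some r ⊙ Some (f a') ⊙ Some (f a) ⪯ omap f (Some a' ⊙ Some a)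
    & exists2 u, B' u & forall x y : A, x <= y ->
        Some u ⊙ Some (f x) ⪯ Some (f y)].

Definition computationally_dense dA (A : opcaType dA) (A' : set A)
    dB (B : opcaType dB) (B' : set B) (f : A -> B) : Prop :=
  exists2 m, B' m &
    forall b', B' b' -> exists2 a', A' a' &
      forall a : A,
        Some m ⊙ omap f (Some a' ⊙ Some a) ⪯ Some b' ⊙ Some (f a).

(* Main.v *)
Require Import Defs.
From HB Require Import structures.
From mathcomp Require Import all_boot all_order.
From mathcomp Require Import boolp classical_sets.

(** Density says that every [b'] of the filter, acting on the elements [f a],
    is tracked by some [a'] of the filter of [A], up to a uniform decoder [m].

    If [f] is dense, track the constant function [k b']: then
    [m f(a' a) <= k b' f(a) <= b'] for every [a], so evaluating [a'] at any
    fixed element of the filter gives a code [h b'], and [t = m] decodes it.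

    Conversely, let [a' a] be a code of the pair of [h b'] and [a]
    ([codes_pairs]).  The morphism carries the two projections of [A] to
    elements of [B'] that recover [f (h b')] and [f a] from [f (a' a)]
    ([morphism_tracks]).  Applying [t] to the former yields [b'], which is then
    applied to the latter.  This recipe does not depend on [b'], and it is a
    polynomial with coefficients in the filter, so a single [m] performs it.

    Polynomials are handled semantically: the partial functions which an element
    of the filter bounds from below ([realizable]) contain the constants and the
    identity and are closed under pointwise application, thanks to [k] and
    [s]; no syntax of terms and no substitution is involved. *)

Set Implicit Arguments.
Unset Strict Implicit.
Unset Printing Implicit Defensive.

Import Order.TTheory.
Local Open Scope order_scope.
Local Open Scope classical_set_scope.
Local Open Scope opca_scope.

Lemma ple_refl d (A : porderType d) (x : option A) : x ⪯ x.
Proof. by move=> b ->; exists b. Qed.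

Lemma ple_trans d (A : porderType d) (y x z : option A) :
  x ⪯ y -> y ⪯ z -> x ⪯ z.
Proof.
move=> xy yz c /yz[b /xy[a -> ab] bc].
by exists a => //; exact: le_trans bc.
Qed.

Lemma ple_Some d (A : porderType d) (a b : A) : a <= b -> Some a ⪯ Some b.
Proof. by move=> ab _ [<-]; exists a. Qed.

Lemma ple_app d (A : opcaType d) (x x' y y' : option A) :
  x ⪯ x' -> y ⪯ y' -> x ⊙ y ⪯ x' ⊙ y'.
Proof.
case: x' => [a'|//]; case: y' => [b'|//].
move=> /(_ _ erefl)[a -> aa'] /(_ _ erefl)[b -> bb'].
exact: opca_app_mono.
Qed.

Section Realizability.
Context {d : Order.disp_t} {A : opcaType d} {A' : set A}.
Hypothesis filtA : opca_filter A'.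

Lemma filter_app (a b c : A) :
  A' a -> A' b -> Some a ⊙ Some b = Some c -> A' c.
Proof. by case: filtA => + _; exact. Qed.

Definition realizable (F : A -> option A) : Prop :=
  exists2 c, A' c & forall a, Some c ⊙ Some a ⪯ F a.

Lemma realizable_cst (c : A) : A' c -> realizable (fun=> Some c).
Proof.
case: filtA => _ [k [s [A'k A's kP sP]]] A'c.
have [kc kcE _] := kP c c _ erefl.
case E : (Some k ⊙ Some c) kcE => [e|//] _.
exists e; first exact: filter_app E.
by move=> a; rewrite -E; exact: kP.
Qed.

Lemma realizable_app (F G : A -> option A) :
  realizable F -> realizable G -> realizable (fun a => F a ⊙ G a).
Proof.
case: filtA => _ [k [s [A'k A's kP [sdef sP]]]] [c A'c cF] [e A'e eG].
case sc : (Some s ⊙ Some c) (sdef c e) => [g|//] _.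
case ge : (Some g ⊙ Some e) (sdef c e) => [h|]; last by rewrite sc ge.
move=> _; exists h; first exact: filter_app (filter_app A's A'c sc) A'e ge.
move=> a; rewrite -ge -sc; apply: ple_trans (sP c e a) _.
exact: ple_app.
Qed.

(** The identity is [s k k], because [k a (k a)] is below [a]. *)
Lemma realizable_id : realizable Some.
Proof.
case: filtA => _ [k [s [A'k A's kP sP]]].
have realk : realizable (fun a => Some k ⊙ Some a).
  by exists k => // a; exact: ple_refl.
have [i A'i iP] := realizable_app realk realk.
exists i => // a; apply: ple_trans (iP a) _.
(* The law of [k] applies to [k a (k a)] only once the argument [k a] is
   known to be defined. *)
case ka : (Some k ⊙ Some a) => [e|]; first by rewrite -{1}ka; exact: kP.
by have [b] := kP a a _ erefl; rewrite ka.
Qed.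

(** The code of the pair of [c] and [a] represents [z |-> z c a]; its
    projections apply it to the two selectors [k] and [k i].  With [g]
    representing [z |-> z c], the element [s g (k a)] is such a code, and it is
    always defined because [s] has received only two arguments. *)
Lemma codes_pairs : exists p0 p1 : A,
  [/\ A' p0, A' p1 & forall c, A' c -> exists2 a', A' a' &
    forall a, exists e, [/\ Some a' ⊙ Some a = Some e,
      Some p0 ⊙ Some e ⪯ Some c & Some p1 ⊙ Some e ⪯ Some a]].
Proof.
case: (filtA) => _ [k [s [A'k A's kP [sdef sP]]]].
have [i A'i iP] := realizable_id.
have [ki A'ki kiP] := realizable_cst A'i.
have [p0 A'p0 p0P] := realizable_app realizable_id (realizable_cst A'k).
have [p1 A'p1 p1P] := realizable_app realizable_id (realizable_cst A'ki).
exists p0, p1; split=> // c A'c.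
have [g A'g gP] := realizable_app realizable_id (realizable_cst A'c).
have [a' A'a' a'P] : realizable (fun a => Some s ⊙ Some g ⊙ (Some k ⊙ Some a)).
  by do ![apply: realizable_app | exact: realizable_cst | exact: realizable_id].
exists a' => // a.
have [ka kaE _] := kP a a _ erefl.
case kaE' : (Some k ⊙ Some a) kaE => [b|//] _.
have [e a'e eb] : exists2 e, Some a' ⊙ Some a = Some e &
    Some e ⪯ Some s ⊙ Some g ⊙ Some b.
  case sgb : (Some s ⊙ Some g ⊙ Some b) (sdef g b) => [h|//] _.
  have [e a'e eh] := a'P a h (etrans (congr1 _ kaE') sgb).
  by exists e => //; exact: ple_Some.
have eP z : Some e ⊙ Some z ⪯ Some z ⊙ Some c ⊙ Some a.
  apply: ple_trans (ple_app eb (@ple_refl _ _ (Some z))) _.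
  apply: ple_trans (sP g b z) _; apply: ple_app => //.
  by rewrite -kaE'; exact: kP.
exists e; split=> //.
  apply: ple_trans (p0P e) _; apply: ple_trans (eP k) _; exact: kP.
apply: ple_trans (p1P e) _; apply: ple_trans (eP ki) _.
apply: ple_trans (iP a).
exact: ple_app (kiP c) (@ple_refl _ _ (Some a)).
Qed.

End Realizability.

(** A realizer [r] of application alone yields a value below [f] of the
    value of [p a]; the realizer [u] of monotonicity is what moves it up to
    [f c]. *)
Lemma morphism_tracks dA (A : opcaType dA) (A' : set A)
    dB (B : opcaType dB) (B' : set B) (f : A -> B) (p : A) :
  opca_filter B' -> applicative_morphism A' B' f -> A' p ->
  exists2 q, B' q & forall a c : A,
    Some p ⊙ Some a ⪯ Some c -> Some q ⊙ Some (f a) ⪯ Some (f c).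
Proof.
move=> filtB [fA' [r B'r rP] [u B'u uP]] /fA'[q0 B'q0 q0p].
have cst := realizable_cst filtB; have idr := realizable_id filtB.
have [q B'q qP] : realizable (A' := B')
    (fun x => Some u ⊙ (Some r ⊙ Some q0 ⊙ Some x)).
  by do ![apply: (realizable_app filtB) | exact: cst | exact: idr].
exists q => // a c pac; apply: ple_trans (qP (f a)) _.
have [e pa ec] := pac _ erefl.
apply: ple_trans (uP _ _ ec); apply: ple_app; first exact: ple_refl.
have := rP p a; rewrite pa; apply: ple_trans.
apply: ple_app; last exact: ple_refl.
by apply: ple_app; [exact: ple_refl | exact: ple_Some].
Qed.

Theorem proposition1p23 (dA dB : Order.disp_t)
    (A : opcaType dA) (A' : set A) (B : opcaType dB) (B' : set B)
    (f : A -> B)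
    (filtA : opca_filter A') (filtB : opca_filter B')
    (morf : applicative_morphism A' B' f) :
  computationally_dense A' B' f <->
  exists (h : B' -> A') (t : B), B' t /\
    forall b' : B', Some t ⊙ Some (f (val (h b'))) ⪯ Some (val b').
Proof.
split=> [[m B'm mP]|[h [t [B't tP]]]].
  have [_ [i [_ [A'i _ _ _]]]] := filtA.
  suff /choice[h hP] : forall b' : B', exists a : A',
      Some m ⊙ Some (f (val a)) ⪯ Some (val b') by exists h, m.
  move=> b'; have B'b' : B' (val b') by exact: set_mem (valP b').
  have [kb' B'kb' kb'P] := realizable_cst filtB B'b'.
  have [a' A'a' a'P] := mP _ B'kb'.
  have := ple_trans (a'P i) (kb'P (f i)).
  (* The left-hand side is undefined if [a' i] is, so the inequality itself
     forces the code to exist. *)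
  case a'i : (Some a' ⊙ Some i) => [a|] maP; last by have [] := maP _ erefl.
  have A'a : a \in A' by apply: mem_set; exact: filter_app a'i.
  by exists (SigSub A'a).
have [p0 [p1 [A'p0 A'p1 pairP]]] := codes_pairs filtA.
have [q0 B'q0 q0P] := morphism_tracks filtB morf A'p0.
have [q1 B'q1 q1P] := morphism_tracks filtB morf A'p1.
have cst := realizable_cst filtB; have idr := realizable_id filtB.
have [m B'm mP] : realizable (A' := B')
    (fun x => Some t ⊙ (Some q0 ⊙ Some x) ⊙ (Some q1 ⊙ Some x)).
  by do ![apply: (realizable_app filtB) | exact: cst | exact: idr].
exists m => // b' B'b'; pose b : B' := SigSub (mem_set B'b').
have [a' A'a' a'P] := pairP _ (set_mem (valP (h b))).
exists a' => // a; have [e [-> p0e p1e]] := a'P a.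
apply: ple_trans (mP (f e)) _; apply: ple_app; last exact: q1P.
apply: ple_trans (tP b); apply: ple_app; [exact: ple_refl | exact: q0P].
Qed.
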